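(* For $p\in\left(0,\frac{3-\sqrt{5}}{2}\right)$ put $q=1-p$ and define $$g_0(p)=\frac{1}{q}\left(\frac{1-2pq}{q\left(1-\sqrt{\frac{2}{p}}\,\ln q\right)}\right)^{\sqrt{p/2}}.$$ Then the set $g_0^{-1}(\{1\})\subset\left(0,\frac{3-\sqrt{5}}{2}\right)$ consists of a single point $p_*$, whose approximate value is $0.1711$. Moreover, the optimal configuration $N_{opt}^{(S)}=N_{opt}^{(S)}(p)$ of the Sterrett group testing scheme, i.e. a positive integer minimizing $N\mapsto t^{(S)}(N,p)$ over the positive integers, where $$t^{(S)}(N,p)=2-q+\frac{2q-p^{-1}(1-q^{N+1})}{N},$$ satisfies: (i) if $p\in\left(p_*,\frac{3-\sqrt{5}}{2}\right)$, then $N_{opt}^{(S)}\in\left\{\lfloor\sqrt{2p^{-1}}\rfloor,\ \lfloor\sqrt{2p^{-1}}\rfloor+1\right\}$; (ii) if $p\in(0,p_*]$, then $N_{opt}^{(S)}\in\left\{\lfloor\sqrt{2p^{-1}}\rfloor,\ \lfloor\sqrt{2p^{-1}}\rfloor+1,\ \lfloor\sqrt{2p^{-1}}\rfloor+2\right\}$.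
   Context: $\lfloor x\rfloor$ denotes the integer part of a real number $x$. Setting: $N$ objects are drawn at random (independently), each being bad with probability $p\in(0,1)$ (the prevalence) and good with probability $q=1-p$. A group testing scheme identifies the bad objects by testing pooled samples; a pool tests positive exactly when it contains at least one bad object. If $T=T(N,p)$ is the total random number of tests used by the scheme on a batch of $N$ objects, then $t(N,p)=\mathrm{E}\,T/N$ is the average number of tests per object. The optimal configuration $N_{opt}$ of the scheme is a value of the positive integer $N$ minimizing $N\mapsto t(N,p)$ for the given $p$. Sterrett scheme (S): the $N$ samples are pooled and tested; if the pool is positive, objects are tested one by one until the first positive appears, and then the remaining objects are pooled and tested; if this remaining pool is positive, the procedure is repeated recursively, until a remaining pool tests negative or all objects have been tested (an object whose status is already determined by earlier outcomes is not tested). For this scheme the average number of tests per object is given by the formula for $t^{(S)}(N,p)$ in the claim; in particular $t^{(S)}(1,p)=1$. *)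

(* Defs.v *)
From Stdlib Require Import Reals List ZArith.
Import ListNotations.
Open Scope R_scope.

(* A batch of N objects is a list of N booleans, [true] meaning "bad". *)
Fixpoint outcomes (N : nat) : list (list bool) :=
  match N with
  | O => [[]]
  | S n => map (cons true) (outcomes n) ++ map (cons false) (outcomes n)
  end.

Definition outcome_prob (p : R) (w : list bool) : R :=
  fold_right (fun (bad : bool) (acc : R) => (if bad then p else 1 - p) * acc) 1 w.

Definition expectation (p : R) (N : nat) (X : list bool -> R) : R :=
  fold_right Rplus 0 (map (fun w => outcome_prob p w * X w) (outcomes N)).

Definition tests_per_object (T : list bool -> nat) (N : nat) (p : R) : R :=
  expectation p N (fun w => INR (T w)) / INR N.

Definition pool_positive (w : list bool) : bool := existsb (fun bad => bad) w.

(* Number of further tests spent on the untested objects [w].  The flag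
   [contaminated] records that earlier outcomes already imply that [w] contains
   a bad object; otherwise nothing is known about [w], and it is pooled first.
   The last object of a contaminated [w] is necessarily bad, hence not tested.
   After an individual test of [b] in a contaminated group, the remaining
   objects are contaminated if [b] is good, and of unknown status if [b] is
   bad. *)
Fixpoint sterrett_from (contaminated : bool) (w : list bool) : nat :=
  match w with
  | [] => 0
  | b :: w' =>
      let one_by_one :=
        match w' with
        | [] => 0
        | _ :: _ => 1 + sterrett_from (negb b) w'
        end%nat in
      if contaminated then one_by_one
      else 1 + (if pool_positive w then one_by_one else 0)
  end%nat.

Definition sterrett_tests (w : list bool) : nat := sterrett_from false w.

Definition tS (N : nat) (p : R) : R := tests_per_object sterrett_tests N p.

Definition optimal_configuration (t : nat -> R -> R) (p : R) (N : nat) : Prop :=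
  (1 <= N)%nat /\ forall M : nat, (1 <= M)%nat -> t N p <= t M p.

Definition g0 (p : R) : R :=
  let q := 1 - p in
  1 / q * Rpower ((1 - 2 * p * q) / (q * (1 - sqrt (2 / p) * ln q))) (sqrt (p / 2)).

(* Main.v *)
Require Import Defs.
From Stdlib Require Import Reals List ZArith Lra Lia.
From Coquelicot Require Import Coquelicot.
Import ListNotations.
Open Scope R_scope.

(** Why the theorem is true.  Put q = 1 - p.

    The formula for the expected number of tests comes from conditioning on the
    first object of a contaminated group: passing from n - 1 to n objects raises
    the expected cost by 1 + p - q^n ([contaminated_cost_succ]).

    With it, t(N+1) - t(N) has the sign of A - D(N), where A = 1 - 2pq
    ([weight_threshold]) and D(x) = q^(x+1) (1 + p x) ([step_weight]).  As D is
    strictly decreasing on [0, +oo), the function t decreases and then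
    increases, and N is optimal exactly when D(N) <= A and, for N > 1,
    A <= D(N-1).  Everything is thus about the position, relative to
    s = sqrt (2/p) and k = floor s, of the point where D crosses A:

    - D(k-1) > A for every p < (3 - sqrt 5)/2 ([step_weight_below_floor]), which
      gives N >= k.  For k >= 4 this follows from D(s-1) > A; for k = 2
      and k = 3 it is a polynomial inequality in p, and k = 2 is where
      (3 - sqrt 5)/2 enters, as a root of 1 - 3p + p^2;
    - D(s+1) < A ([step_weight_after]), which gives N <= k+2;
    - D(s) < q^(s+1) (1 - s ln q), so that D(s) < A, and hence N <= k+1, as soon
      as the right-hand side is at most A ([step_weight_at]).

    The parameter u = sqrt (2p) makes p = u^2/2 and s = 2/u rational functions.
    The function [excess] is the logarithm of q^(s+1) (1 - s ln q) / A, and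
    ln (g0 p) = - (u/2) * excess u ([g0_excess]); so g0 = 1 means that [excess]
    vanishes, and p > pstar that it is negative.  It remains to see that
    [excess] changes sign once, from positive to negative, near u = 0.58504.
    It behaves like u^3/3 at 0 and is shown positive on (0, 1/2] by rational
    bounds on the logarithms ([excess_pos_small]); from 1/2 on its derivative is
    negative ([excess_deriv_neg]); and its values at 31/53 and 0.58506 have
    opposite signs ([excess_root_left], [excess_root_right]), which also locates
    the root. *)

(** * The expected number of tests *)

Lemma fold_Rplus_app (l l' : list R) :
  fold_right Rplus 0 (l ++ l') = fold_right Rplus 0 l + fold_right Rplus 0 l'.
Proof.
  induction l as [| a l IH]; simpl; [ring | rewrite IH; ring].
Qed.

Lemma fold_Rplus_scale {A : Type} (c : R) (f : A -> R) (l : list A) :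
  fold_right Rplus 0 (map (fun w => c * f w) l) = c * fold_right Rplus 0 (map f l).
Proof.
  induction l as [| a l IH]; simpl; [ring | rewrite IH; ring].
Qed.

Lemma expectation_succ (p : R) (n : nat) (X : list bool -> R) :
  expectation p (S n) X =
  p * expectation p n (fun w => X (true :: w))
  + (1 - p) * expectation p n (fun w => X (false :: w)).
Proof.
  unfold expectation. simpl.
  rewrite map_app, fold_Rplus_app, !map_map, <- !fold_Rplus_scale.
  f_equal; f_equal; apply map_ext; intros w; simpl; ring.
Qed.

Lemma expectation_plus (p : R) (n : nat) (X Y : list bool -> R) :
  expectation p n (fun w => X w + Y w) = expectation p n X + expectation p n Y.
Proof.
  unfold expectation. induction (outcomes n) as [| w l IH]; simpl; [ring |].
  rewrite IH. ring.
Qed.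

Lemma expectation_const (p c : R) (n : nat) : expectation p n (fun _ => c) = c.
Proof.
  induction n as [| n IH].
  - unfold expectation. simpl. ring.
  - rewrite expectation_succ, IH. ring.
Qed.

Lemma outcomes_length (n : nat) (w : list bool) : In w (outcomes n) -> length w = n.
Proof.
  revert w. induction n as [| n IH]; simpl; intros w.
  - intros [<- | []]. reflexivity.
  - rewrite in_app_iff, !in_map_iff.
    intros [[v [<- Hv]] | [v [<- Hv]]]; simpl; f_equal; auto.
Qed.

Lemma expectation_ext (p : R) (n : nat) (X Y : list bool -> R) :
  (forall w, length w = n -> X w = Y w) -> expectation p n X = expectation p n Y.
Proof.
  intros H. unfold expectation. f_equal. apply map_ext_in.
  intros w Hw. rewrite (H w); [reflexivity |]. apply outcomes_length, Hw.
Qed.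

Definition indicator (b : bool) : R := if b then 1 else 0.

Lemma expectation_pool_positive (p : R) (n : nat) :
  expectation p n (fun w => indicator (pool_positive w)) = 1 - (1 - p) ^ n.
Proof.
  induction n as [| n IH].
  - unfold expectation. simpl. ring.
  - rewrite expectation_succ. unfold pool_positive in *. simpl.
    rewrite IH, expectation_const. ring.
Qed.

(** Restricting to positive pools makes this satisfy a recursion: the count for a
    contaminated group without bad objects is never incurred. *)
Definition contaminated_cost (p : R) (n : nat) : R :=
  expectation p n (fun w => indicator (pool_positive w) * INR (sterrett_from true w)).

Lemma expected_tests_succ (p : R) (n : nat) :
  expectation p (S n) (fun w => INR (sterrett_tests w)) = 1 + contaminated_cost p (S n).
Proof.
  unfold contaminated_cost.
  rewrite <- (expectation_const p 1 (S n)), <- expectation_plus. apply expectation_ext.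
  intros [| b w] Hw; [discriminate |].
  unfold sterrett_tests.
  change (sterrett_from false (b :: w)) with
    (1 + (if pool_positive (b :: w) then sterrett_from true (b :: w) else 0))%nat.
  rewrite plus_INR. destruct (pool_positive (b :: w)); simpl (indicator _);
    simpl (INR 0); simpl (INR 1); ring.
Qed.

(** A bad first object costs its own test and opens a fresh group; a good one
    costs its test, provided that the rest holds a bad object, and leaves the
    rest contaminated. *)
Lemma contaminated_cost_succ (p : R) (n : nat) :
  contaminated_cost p (S (S n)) =
  contaminated_cost p (S n) + 1 + p - (1 - p) ^ (S (S n)).
Proof.
  transitivity (p * (1 + (1 + contaminated_cost p (S n)))
    + (1 - p) * ((1 - (1 - p) ^ S n) + contaminated_cost p (S n))).
  2: { simpl. ring. }
  rewrite <- expected_tests_succ, <- (expectation_pool_positive p (S n)).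
  unfold contaminated_cost at 1. rewrite expectation_succ. f_equal; f_equal.
  - rewrite <- (expectation_const p 1 (S n)), <- expectation_plus. apply expectation_ext.
    intros [| b w] Hw; [discriminate |].
    change (sterrett_from true (true :: b :: w)) with (1 + sterrett_tests (b :: w))%nat.
    rewrite plus_INR. simpl (indicator _). simpl (INR 1). ring.
  - unfold contaminated_cost. rewrite <- expectation_plus. apply expectation_ext.
    intros [| b w] Hw; [discriminate |].
    change (sterrett_from true (false :: b :: w)) with (1 + sterrett_from true (b :: w))%nat.
    change (pool_positive (false :: b :: w)) with (pool_positive (b :: w)).
    rewrite plus_INR. simpl (INR 1). ring.
Qed.

Lemma tS_formula (p : R) (N : nat) :
  0 < p < 1 -> (1 <= N)%nat ->
  tS N p = 2 - (1 - p) + (2 * (1 - p) - / p * (1 - (1 - p) ^ (N + 1))) / INR N.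
Proof.
  intros Hp HN. destruct N as [| n]; [lia |].
  unfold tS, tests_per_object. rewrite expected_tests_succ.
  assert (HC : contaminated_cost p (S n)
               = INR (S n) * (1 + p) + 2 * (1 - p) - / p * (1 - (1 - p) ^ (S n + 1)) - 1).
  { clear HN. induction n as [| n IH].
    - unfold contaminated_cost, expectation. simpl. field. lra.
    - rewrite contaminated_cost_succ, IH, (S_INR (S n)), !Nat.add_1_r.
      rewrite <- !tech_pow_Rmult. field. lra. }
  rewrite HC. field. split; [lra |]. apply not_0_INR. lia.
Qed.

(** * Elementary bounds for exp and ln *)

Lemma increasing_of_deriv_pos (f f' : R -> R) (a b : R) :
  a < b ->
  (forall x, a <= x <= b -> is_derive f x (f' x)) ->
  (forall x, a < x < b -> 0 < f' x) ->
  f a < f b.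
Proof.
  intros Hab Hd Hpos.
  destruct (MVT_cor2 f f' a b Hab) as [c [Hc Hac]].
  - intros x Hx. apply is_derive_Reals, Hd, Hx.
  - specialize (Hpos c Hac). nra.
Qed.

Lemma nondecreasing_of_deriv_nonneg (f f' : R -> R) (a b : R) :
  a <= b ->
  (forall x, a <= x <= b -> is_derive f x (f' x)) ->
  (forall x, a < x < b -> 0 <= f' x) ->
  f a <= f b.
Proof.
  intros [Hab | ->] Hd Hpos; [| lra].
  destruct (MVT_cor2 f f' a b Hab) as [c [Hc Hac]].
  - intros x Hx. apply is_derive_Reals, Hd, Hx.
  - specialize (Hpos c Hac). nra.
Qed.

Lemma exp_gt_taylor2 (u : R) : 0 < u -> 1 + u + u ^ 2 / 2 < exp u.
Proof.
  intros Hu.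
  enough (H : exp 0 - (1 + 0 + 0 ^ 2 / 2) < exp u - (1 + u + u ^ 2 / 2))
    by (rewrite exp_0 in H; lra).
  apply (increasing_of_deriv_pos (fun x => exp x - (1 + x + x ^ 2 / 2))
           (fun x => exp x - (1 + x))); trivial.
  - intros x _. auto_derive; trivial. field.
  - intros x Hx. pose proof (exp_ineq1 x). lra.
Qed.

Lemma exp_opp_le_taylor2 (v : R) : 0 <= v -> exp (- v) <= 1 - v + v ^ 2 / 2.
Proof.
  intros Hv.
  enough (H : (1 - 0 + 0 ^ 2 / 2) - exp (- 0) <= (1 - v + v ^ 2 / 2) - exp (- v))
    by (rewrite Ropp_0, exp_0 in H; lra).
  apply (nondecreasing_of_deriv_nonneg (fun x => (1 - x + x ^ 2 / 2) - exp (- x))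
           (fun x => exp (- x) - (1 - x))); trivial.
  - intros x _. auto_derive; trivial. field.
  - intros x Hx. pose proof (exp_ineq1_le (- x)). lra.
Qed.

(** The [2/2] Pade approximant of ln (1 + y) at 0: its error is of order y^5, so a
    single rational expression is accurate enough until y slightly exceeds 1/2. *)
Lemma ln_ge_pade (y : R) :
  0 <= y -> 3 * y * (2 + y) / (6 + 6 * y + y ^ 2) <= ln (1 + y).
Proof.
  intros Hy.
  enough (H : ln (1 + 0) - 3 * 0 * (2 + 0) / (6 + 6 * 0 + 0 ^ 2)
              <= ln (1 + y) - 3 * y * (2 + y) / (6 + 6 * y + y ^ 2)).
  { replace (1 + 0) with 1 in H by ring. rewrite ln_1 in H. lra. }
  apply (nondecreasing_of_deriv_nonneg
           (fun y => ln (1 + y) - 3 * y * (2 + y) / (6 + 6 * y + y ^ 2))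
           (fun y => y ^ 4 / ((1 + y) * (6 + 6 * y + y ^ 2) ^ 2))); trivial.
  - intros x Hx.
    assert (0 < 6 + 6 * x + x ^ 2) by nra.
    auto_derive; [repeat split; lra |].
    field; repeat split; lra.
  - intros x Hx. apply Rlt_le, Rdiv_lt_0_compat; [apply pow_lt; lra |].
    apply Rmult_lt_0_compat; [| apply pow_lt]; nra.
Qed.

(** The expansion of - ln (1 - v + v^2/2) is v - v^3/6 + ...: there is no
    quadratic term, and 1/4 in place of 1/6 absorbs the higher orders. *)
Lemma ln_quadratic_le (v : R) :
  0 <= v <= 2 / 5 -> ln (1 - v + v ^ 2 / 2) <= - (v - v ^ 3 / 4).
Proof.
  intros Hv.
  enough (H : - (0 - 0 ^ 3 / 4) - ln (1 - 0 + 0 ^ 2 / 2)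
              <= - (v - v ^ 3 / 4) - ln (1 - v + v ^ 2 / 2)).
  { replace (1 - 0 + 0 ^ 2 / 2) with 1 in H by field. rewrite ln_1 in H. lra. }
  apply (nondecreasing_of_deriv_nonneg
           (fun v => - (v - v ^ 3 / 4) - ln (1 - v + v ^ 2 / 2))
           (fun v => v ^ 2 / 4 * (1 - 3 * v + 3 / 2 * v ^ 2) / (1 - v + v ^ 2 / 2))).
  - lra.
  - intros x Hx.
    assert (0 < 1 - x + x ^ 2 / 2) by nra.
    auto_derive; [lra |]. field; lra.
  - intros x Hx. apply Rlt_le, Rdiv_lt_0_compat; [| nra].
    apply Rmult_lt_0_compat; nra.
Qed.

Lemma opp_ln_ge (p : R) : 0 <= p < 1 -> p + p ^ 2 / 2 <= - ln (1 - p).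
Proof.
  intros Hp.
  enough (H : - ln (1 - 0) - (0 + 0 ^ 2 / 2) <= - ln (1 - p) - (p + p ^ 2 / 2)).
  { rewrite Rminus_0_r, ln_1 in H. lra. }
  apply (nondecreasing_of_deriv_nonneg (fun p => - ln (1 - p) - (p + p ^ 2 / 2))
           (fun p => p ^ 2 / (1 - p))).
  - lra.
  - intros x Hx. auto_derive; [lra |]. field; lra.
  - intros x Hx. apply Rlt_le, Rdiv_lt_0_compat; nra.
Qed.

Lemma opp_ln_le (a p : R) :
  0 <= p <= a -> a < 1 -> - ln (1 - p) <= p + p ^ 2 / (2 * (1 - a)).
Proof.
  intros Hp Ha.
  enough (H : 0 + 0 ^ 2 / (2 * (1 - a)) + ln (1 - 0)
              <= p + p ^ 2 / (2 * (1 - a)) + ln (1 - p)).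
  { rewrite Rminus_0_r, ln_1 in H. unfold Rdiv in *. lra. }
  apply (nondecreasing_of_deriv_nonneg
           (fun p => p + p ^ 2 / (2 * (1 - a)) + ln (1 - p))
           (fun p => p * (a - p) / ((1 - a) * (1 - p)))).
  - lra.
  - intros x Hx. auto_derive; [lra |]. field; lra.
  - intros x Hx. apply Rlt_le, Rdiv_lt_0_compat; apply Rmult_lt_0_compat; lra.
Qed.

(** The series of 2 artanh t = ln ((1 + t) / (1 - t)), truncated to five terms. *)
Definition artanh5 (t : R) : R :=
  2 * (t + t ^ 3 / 3 + t ^ 5 / 5 + t ^ 7 / 7 + t ^ 9 / 9).

Lemma ln_ratio_bounds (t : R) :
  0 <= t <= 1 / 2 ->
  artanh5 t <= ln ((1 + t) / (1 - t)) <= artanh5 t + t ^ 11 / 4.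
Proof.
  intros Ht.
  rewrite ln_div by lra. unfold artanh5. split.
  - set (f := fun t => ln (1 + t) - ln (1 - t)
       - 2 * (t + t ^ 3 / 3 + t ^ 5 / 5 + t ^ 7 / 7 + t ^ 9 / 9)).
    enough (H : f 0 <= f t).
    { unfold f in H. rewrite Rplus_0_r, Rminus_0_r, ln_1 in H. lra. }
    apply (nondecreasing_of_deriv_nonneg f (fun t => 2 * t ^ 10 / (1 - t ^ 2))).
    + lra.
    + intros x Hx. assert (1 - x ^ 2 <> 0) by nra. unfold f.
      auto_derive; [split; [| split]; lra |]. field. repeat split; try lra; nra.
    + intros x Hx. pose proof (pow_lt x 10).
      apply Rlt_le, Rdiv_lt_0_compat; nra.
  - set (f := fun t =>
       2 * (t + t ^ 3 / 3 + t ^ 5 / 5 + t ^ 7 / 7 + t ^ 9 / 9) + t ^ 11 / 4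
       - (ln (1 + t) - ln (1 - t))).
    enough (H : f 0 <= f t).
    { unfold f in H. rewrite Rplus_0_r, Rminus_0_r, ln_1 in H. lra. }
    apply (nondecreasing_of_deriv_nonneg f
       (fun t => t ^ 10 * (3 / 4 - 11 / 4 * t ^ 2) / (1 - t ^ 2))).
    + lra.
    + intros x Hx. assert (1 - x ^ 2 <> 0) by nra. unfold f.
      auto_derive; [split; [| split]; lra |]. field. repeat split; try lra; nra.
    + intros x Hx. pose proof (pow_lt x 10).
      apply Rlt_le, Rdiv_lt_0_compat; [| nra].
      apply Rmult_lt_0_compat; nra.
Qed.

(** * The sign of the excess *)

(** With p = u^2/2, q = 1 - p and s = 2/u, this is
    ln (1 - s ln q) + (s + 1) ln q - ln (1 - 2pq). *)
Definition excess (u : R) : R :=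
  ln (1 - 2 / u * ln (1 - u ^ 2 / 2)) + (2 / u + 1) * ln (1 - u ^ 2 / 2)
  - ln (1 - u ^ 2 + u ^ 4 / 2).

(** Since ln q = - (u/2) y, all the dependence on ln q goes through y = - s ln q. *)
Lemma excess_eq (u y : R) :
  0 < u -> y = - (2 / u * ln (1 - u ^ 2 / 2)) ->
  excess u = ln (1 + y) - (1 + u / 2) * y - ln (1 - u ^ 2 + u ^ 4 / 2).
Proof.
  intros Hu ->. unfold excess, Rminus. f_equal. f_equal. field. lra.
Qed.

(** The derivative of [excess], where dy/du = 2/q - y/u.  Keeping y as a separate
    argument leaves a rational function, to be estimated with bounds on y only. *)
Definition excess_deriv (u y : R) : R :=
  - (y * (2 / (1 - u ^ 2 / 2) - y / u)) / (1 + y) - u / (1 - u ^ 2 / 2)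
  + 2 * u * (1 - u ^ 2) / (1 - u ^ 2 + u ^ 4 / 2).

(** Both bounds have the form u (1 + c u^2): a quadratic approximation of ln q is
    precise enough everywhere except for the two numerical evaluations. *)
Lemma scaled_log_bounds (u a : R) :
  0 < u -> u ^ 2 / 2 <= a -> a < 1 ->
  u * (1 + u ^ 2 / 4) <= - (2 / u * ln (1 - u ^ 2 / 2))
  <= u * (1 + u ^ 2 / (4 * (1 - a))).
Proof.
  intros Hu Hp Ha.
  assert (Hp0 : 0 < u ^ 2 / 2) by nra.
  pose proof (opp_ln_ge (u ^ 2 / 2) ltac:(lra)) as H1.
  pose proof (opp_ln_le a (u ^ 2 / 2) ltac:(lra) Ha) as H2.
  assert (Hs : 0 < 2 / u) by (apply Rdiv_lt_0_compat; lra).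
  replace (u * (1 + u ^ 2 / 4)) with (2 / u * (u ^ 2 / 2 + (u ^ 2 / 2) ^ 2 / 2)) by (field; lra).
  replace (u * (1 + u ^ 2 / (4 * (1 - a))))
    with (2 / u * (u ^ 2 / 2 + (u ^ 2 / 2) ^ 2 / (2 * (1 - a)))) by (field; lra).
  rewrite Ropp_mult_distr_r.
  split; apply Rmult_le_compat_l; lra.
Qed.

Lemma excess_derive (u : R) :
  0 < u < 1 ->
  is_derive excess u (excess_deriv u (- (2 / u * ln (1 - u ^ 2 / 2)))).
Proof.
  intros Hu.
  assert (Hq : 0 < 1 - u ^ 2 / 2) by nra.
  assert (HA : 0 < 1 - u ^ 2 + u ^ 4 / 2) by nra.
  destruct (scaled_log_bounds u (1 / 2) ltac:(lra) ltac:(nra) ltac:(lra)) as [Hy _].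
  assert (Hy1 : 0 < 1 - 2 / u * ln (1 - u ^ 2 / 2)) by nra.
  unfold excess, excess_deriv.
  auto_derive.
  - replace (1 + - (u * (u * 1) * / 2)) with (1 - u ^ 2 / 2) by field.
    unfold Rdiv, Rminus in *. repeat split; simpl in *; lra.
  - replace (1 + - (u * (u * 1) * / 2)) with (1 - u ^ 2 / 2) by field.
    set (l := ln (1 - u ^ 2 / 2)) in *.
    assert (0 < u - 2 * l).
    { replace (u - 2 * l) with (u * (1 - 2 / u * l)) by (field; lra). nra. }
    field. repeat split; lra.
Qed.

(** With y = u z and v = u^2, clearing denominators turns the claim into
    A (q z^2 - 2z) + (1 + u z) B < 0, where B = 1 - 2v + v^2/2.  The first term is
    negative because q z is close to 1; the second matters only when B > 0, which
    forces v < 3/5, and then q (q z^2 - 2z) = (1 - q z)^2 - 1 is nearly -1. *)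
Lemma excess_deriv_neg (u : R) :
  1 / 2 <= u -> u ^ 2 / 2 <= 382 / 1000 ->
  excess_deriv u (- (2 / u * ln (1 - u ^ 2 / 2))) < 0.
Proof.
  intros Hu Hp.
  destruct (scaled_log_bounds u (382 / 1000) ltac:(lra) Hp ltac:(lra)) as [Hy0 Hy1].
  set (y := - (2 / u * ln (1 - u ^ 2 / 2))) in *.
  set (z := y / u).
  assert (Ez : y = u * z) by (unfold z; field; lra).
  clearbody z.
  rewrite Ez in Hy0, Hy1.
  apply Rmult_le_reg_l in Hy0; [| lra].
  apply Rmult_le_reg_l in Hy1; [| lra].
  set (v := u ^ 2) in *.
  set (A := 1 - v + v ^ 2 / 2).
  set (q := 1 - v / 2).
  assert (Hv : 1 / 4 <= v) by (unfold v; nra).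
  assert (Hu1 : u <= 7 / 8) by (unfold v in *; nra).
  assert (0 < A) by (unfold A; nra).
  assert (0 < q) by (unfold q; nra).
  assert (Hz : 0 < 1 + u * z) by nra.
  replace (excess_deriv u y) with
    (u / ((1 + u * z) * q * A) *
     (A * (q * z ^ 2 - 2 * z) + (1 + u * z) * (1 - 2 * v + v ^ 2 / 2))).
  2: { rewrite Ez. unfold excess_deriv, A, q, v in *. field. repeat split; nra. }
  assert (0 < u / ((1 + u * z) * q * A)).
  { apply Rdiv_lt_0_compat; [lra |]. repeat apply Rmult_lt_0_compat; trivial. }
  enough (A * (q * z ^ 2 - 2 * z) + (1 + u * z) * (1 - 2 * v + v ^ 2 / 2) < 0) by nra.
  destruct (Rle_or_lt (1 - 2 * v + v ^ 2 / 2) 0) as [HB | HB].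
  - assert (z <= 2) by (unfold Rdiv in Hy1; nra).
    assert (q * z < 2) by (unfold q in *; nra).
    assert (0 < z) by (unfold Rdiv in *; nra).
    assert (0 < A * (z * (2 - q * z))) by (repeat apply Rmult_lt_0_compat; lra).
    nra.
  - assert (Hv1 : v < 3 / 5) by nra.
    assert (Hw : (1 - q * z) ^ 2 <= (v * (2 + v) / 8) ^ 2).
    { apply pow_maj_Rabs, Rabs_le. unfold q. split; nra. }
    assert (Huz : u * z <= (v + 1 / 4) * (1 + v / (4 * (1 - 382 / 1000)))).
    { (* u <= v + 1/4 is (u - 1/2)^2 >= 0; it removes the odd powers of u. *)
      apply Rmult_le_compat; try lra; unfold v; nra. }
    set (b := v / (4 * (1 - 382 / 1000))) in *.
    assert (Hb : b <= 41 / 100 * v) by (unfold b; lra).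
    apply Rmult_lt_reg_l with q; trivial.
    replace (q * (A * (q * z ^ 2 - 2 * z) + (1 + u * z) * (1 - 2 * v + v ^ 2 / 2)))
      with (q * (1 - 2 * v + v ^ 2 / 2) * (1 + u * z) - A * (1 - (1 - q * z) ^ 2))
      by ring.
    assert (HqB : 0 < q * (1 - 2 * v + v ^ 2 / 2)) by nra.
    apply Rle_lt_trans with
      (q * (1 - 2 * v + v ^ 2 / 2) * (1 + (v + 1 / 4) * (1 + 41 / 100 * v))
       - A * (1 - (v * (2 + v) / 8) ^ 2)).
    { apply Rplus_le_compat.
      - apply Rmult_le_compat_l; nra.
      - apply Ropp_le_contravar, Rmult_le_compat_l; lra. }
    rewrite Rmult_0_r. unfold q, A.
    clear - Hv Hv1 HB.
    (* Linear and constant bounds on the slowly varying factors leave a cubic. *)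
    assert (Ha : (1 - v / 2) * (1 + (v + 1 / 4) * (1 + 41 / 100 * v))
                 <= 128 / 100 + 35 / 100 * v) by nra.
    assert (Hc : (v * (2 + v) / 8) ^ 2 <= 4 / 100) by nra.
    assert (HA : 0 < 1 - v + v ^ 2 / 2) by nra.
    nra.
Qed.

Lemma pow_le_half (u : R) (k : nat) : 0 <= u <= 1 / 2 -> 0 <= u ^ k <= (1 / 2) ^ k.
Proof.
  intros Hu. split; [apply pow_le | apply pow_incr]; lra.
Qed.

(** The excess decreases with y, so y can be replaced by its upper bound Y.  The
    bounds together are exact up to order u^3, the order at which the excess
    starts; what is left is u^3 times a polynomial whose constant coefficient is
    its only positive one. *)
Lemma excess_pos_small (u : R) : 0 < u <= 1 / 2 -> 0 < excess u.
Proof.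
  intros Hu.
  destruct (scaled_log_bounds u (1 / 8) ltac:(lra) ltac:(nra) ltac:(lra)) as [Hy0 Hy1].
  rewrite (excess_eq u _ (proj1 Hu) eq_refl).
  set (y := - (2 / u * ln (1 - u ^ 2 / 2))) in *. clearbody y.
  pose proof (ln_quadratic_le (u ^ 2) ltac:(nra)) as HlnA.
  replace ((u ^ 2) ^ 2) with (u ^ 4) in HlnA by ring.
  set (Y := u * (1 + u ^ 2 / (4 * (1 - 1 / 8)))) in *.
  assert (Hy : 0 < y) by nra.
  (* ln (1 + y) is 1-Lipschitz for y >= 0. *)
  assert (HYy : ln (1 + Y) - ln (1 + y) <= Y - y).
  { rewrite <- ln_div by lra.
    replace ((1 + Y) / (1 + y)) with (1 + (Y - y) / (1 + y)) by (field; lra).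
    assert (Hd : 0 <= (Y - y) / (1 + y) <= Y - y).
    { split; [apply Rdiv_le_0_compat; lra |].
      apply Rle_div_l; [lra |]. nra. }
    apply Rle_trans with (ln (exp ((Y - y) / (1 + y)))); [| rewrite ln_exp; lra].
    apply ln_le; [lra | apply exp_ineq1_le]. }
  pose proof (ln_ge_pade Y ltac:(lra)) as HY.
  enough (0 < 3 * Y * (2 + Y) / (6 + 6 * Y + Y ^ 2)
              - (1 + u / 2) * Y + (u ^ 2 - (u ^ 2) ^ 3 / 4)) by nra.
  assert (HD : 0 < 6 + 6 * Y + Y ^ 2) by nra.
  replace (3 * Y * (2 + Y) / (6 + 6 * Y + Y ^ 2) - (1 + u / 2) * Y
           + (u ^ 2 - (u ^ 2) ^ 3 / 4))
    with (u ^ 3 * (2 - 29 / 14 * u - 6 / 7 * u ^ 2 - 157 / 98 * u ^ 3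
                   - 195 / 98 * u ^ 4 - 57 / 196 * u ^ 5 - 155 / 343 * u ^ 6
                   - 53 / 343 * u ^ 7 - 1 / 49 * u ^ 9) / (6 + 6 * Y + Y ^ 2)).
  2: { unfold Y in *. field. lra. }
  apply Rdiv_lt_0_compat; trivial.
  apply Rmult_lt_0_compat; [apply pow_lt; lra |].
  pose proof (pow_le_half u 2 ltac:(lra)). pose proof (pow_le_half u 3 ltac:(lra)).
  pose proof (pow_le_half u 4 ltac:(lra)). pose proof (pow_le_half u 5 ltac:(lra)).
  pose proof (pow_le_half u 6 ltac:(lra)). pose proof (pow_le_half u 7 ltac:(lra)).
  pose proof (pow_le_half u 9 ltac:(lra)).
  lra.
Qed.

(** The logarithm of A < D(s-1), by the same method: the difference of the two
    sides starts with a positive multiple of u^3. *)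
Lemma shifted_bound_small (u : R) :
  0 < u <= 1 / 2 ->
  ln (1 - u ^ 2 + u ^ 4 / 2) < ln (1 + (u - u ^ 2 / 2)) + 2 / u * ln (1 - u ^ 2 / 2).
Proof.
  intros Hu.
  destruct (scaled_log_bounds u (1 / 8) ltac:(lra) ltac:(nra) ltac:(lra)) as [_ Hy].
  pose proof (ln_quadratic_le (u ^ 2) ltac:(nra)) as HlnA.
  replace ((u ^ 2) ^ 2) with (u ^ 4) in HlnA by ring.
  set (x := u - u ^ 2 / 2).
  assert (Hx : 0 < x) by (unfold x; nra).
  pose proof (ln_ge_pade x ltac:(lra)) as Hlnx.
  enough (0 < 3 * x * (2 + x) / (6 + 6 * x + x ^ 2)
              - u * (1 + u ^ 2 / (4 * (1 - 1 / 8))) + (u ^ 2 - (u ^ 2) ^ 3 / 4)) by lra.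
  assert (HD : 0 < 6 + 6 * x + x ^ 2) by nra.
  replace (3 * x * (2 + x) / (6 + 6 * x + x ^ 2)
              - u * (1 + u ^ 2 / (4 * (1 - 1 / 8))) + (u ^ 2 - (u ^ 2) ^ 3 / 4))
    with (u ^ 3 * (23 / 7 - 55 / 28 * u - 19 / 28 * u ^ 2 - 27 / 28 * u ^ 3
                   - 11 / 7 * u ^ 4 + 1 / 2 * u ^ 5 + 1 / 4 * u ^ 6
                   - 1 / 16 * u ^ 7) / (6 + 6 * x + x ^ 2)).
  2: { unfold x in *. field. lra. }
  apply Rdiv_lt_0_compat; trivial.
  apply Rmult_lt_0_compat; [apply pow_lt; lra |].
  pose proof (pow_le_half u 2 ltac:(lra)). pose proof (pow_le_half u 3 ltac:(lra)).
  pose proof (pow_le_half u 4 ltac:(lra)). pose proof (pow_le_half u 5 ltac:(lra)).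
  pose proof (pow_le_half u 6 ltac:(lra)). pose proof (pow_le_half u 7 ltac:(lra)).
  lra.
Qed.

Lemma ln_bounds (x : R) :
  1 <= x <= 3 ->
  artanh5 ((x - 1) / (x + 1)) <= ln x
  <= artanh5 ((x - 1) / (x + 1)) + ((x - 1) / (x + 1)) ^ 11 / 4.
Proof.
  intros Hx.
  replace (ln x) with (ln ((1 + (x - 1) / (x + 1)) / (1 - (x - 1) / (x + 1))))
    by (f_equal; field; lra).
  apply ln_ratio_bounds. split.
  - apply Rdiv_le_0_compat; lra.
  - apply Rle_div_l; lra.
Qed.

(** The rational 31/53 exceeds sqrt (2 * 0.17105) and lies below the root by only
    about 0.00013, so the logarithms are needed to about six decimals. *)
Lemma excess_root_left : 0 < excess (31 / 53).
Proof.
  rewrite (excess_eq (31 / 53) _ ltac:(lra) eq_refl).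
  assert (HL : 187604 / 1000000 <= - ln (1 - (31 / 53) ^ 2 / 2) <= 187605 / 1000000).
  { rewrite <- ln_Rinv by lra.
    pose proof (ln_bounds (/ (1 - (31 / 53) ^ 2 / 2)) ltac:(lra)) as H.
    unfold artanh5 in H. lra. }
  set (l := ln (1 - (31 / 53) ^ 2 / 2)) in *.
  assert (HA : 3335073 / 10000000 <= - ln (1 - (31 / 53) ^ 2 + (31 / 53) ^ 4 / 2)).
  { rewrite <- ln_Rinv by lra.
    pose proof (ln_bounds (/ (1 - (31 / 53) ^ 2 + (31 / 53) ^ 4 / 2)) ltac:(lra)) as H.
    unfold artanh5 in H. lra. }
  assert (HY : 4955998 / 10000000 <= ln (1 + - (2 / (31 / 53) * l))).
  { apply Rle_trans with (ln (1641484 / 1000000)).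
    - pose proof (ln_bounds (1641484 / 1000000) ltac:(lra)) as H.
      unfold artanh5 in H. lra.
    - apply ln_le; lra. }
  lra.
Qed.

(** The decimal 0.58506 is below sqrt (2 * 0.17115) and above the root by only
    about 0.00002; the excess there is about -0.000003, whence the seven and more decimals. *)
Lemma excess_root_right : excess (58506 / 100000) < 0.
Proof.
  rewrite (excess_eq (58506 / 100000) _ ltac:(lra) eq_refl).
  assert (HL : 18771318 / 100000000 <= - ln (1 - (58506 / 100000) ^ 2 / 2)
               <= 18771319 / 100000000).
  { rewrite <- ln_Rinv by lra.
    pose proof (ln_bounds (/ (1 - (58506 / 100000) ^ 2 / 2)) ltac:(lra)) as H.
    unfold artanh5 in H. lra. }
  set (l := ln (1 - (58506 / 100000) ^ 2 / 2)) in *.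
  assert (HA : - ln (1 - (58506 / 100000) ^ 2 + (58506 / 100000) ^ 4 / 2)
               <= 3336733 / 10000000).
  { rewrite <- ln_Rinv by lra.
    pose proof (ln_bounds (/ (1 - (58506 / 100000) ^ 2 + (58506 / 100000) ^ 4 / 2))
                  ltac:(lra)) as H.
    unfold artanh5 in H. lra. }
  assert (HY : ln (1 + - (2 / (58506 / 100000) * l)) <= 4957255 / 10000000).
  { apply Rle_trans with (ln (16416888 / 10000000)).
    - apply ln_le; lra.
    - pose proof (ln_bounds (16416888 / 10000000) ltac:(lra)) as H.
      unfold artanh5 in H. lra. }
  lra.
Qed.

Lemma excess_strictly_decreasing (a b : R) :
  1 / 2 <= a < b -> b ^ 2 / 2 <= 382 / 1000 -> excess b < excess a.
Proof.
  intros Hab Hb.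
  assert (b < 1) by nra.
  apply Ropp_lt_cancel.
  apply (increasing_of_deriv_pos (fun u => - excess u)
           (fun u => - excess_deriv u (- (2 / u * ln (1 - u ^ 2 / 2))))); [lra | |].
  - intros u Hu. apply (is_derive_opp excess), excess_derive. lra.
  - intros u Hu. pose proof (excess_deriv_neg u ltac:(lra) ltac:(nra)). lra.
Qed.

Lemma excess_sign :
  exists ustar : R,
    31 / 53 <= ustar <= 58506 / 100000 /\ excess ustar = 0 /\
    (forall u, 0 < u < ustar -> 0 < excess u) /\
    (forall u, ustar < u -> u ^ 2 / 2 <= 382 / 1000 -> excess u < 0).
Proof.
  destruct (Ranalysis5.IVT_interv (fun u => - excess u) (31 / 53) (58506 / 100000))
    as [ustar [Hu Hroot]].
  - intros u Hu. apply continuity_pt_opp.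
    apply derivable_continuous_pt.
    eexists. apply is_derive_Reals, excess_derive. lra.
  - lra.
  - pose proof excess_root_left. lra.
  - pose proof excess_root_right. lra.
  - assert (H0 : excess ustar = 0) by lra.
    exists ustar. split; [exact Hu | split; [exact H0 | split]].
    + intros u Hlt. destruct (Rle_or_lt u (1 / 2)).
      * apply excess_pos_small. lra.
      * rewrite <- H0. apply excess_strictly_decreasing; [lra | nra].
    + intros u Hlt Hle. rewrite <- H0. apply excess_strictly_decreasing; lra.
Qed.

Lemma sqrt_two_div (u : R) : 0 < u -> sqrt (2 / (u ^ 2 / 2)) = 2 / u.
Proof.
  intros Hu. replace (2 / (u ^ 2 / 2)) with (2 / u * (2 / u)) by (field; lra).
  apply sqrt_square, Rlt_le, Rdiv_lt_0_compat; lra.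
Qed.

Lemma g0_excess (u : R) : 0 < u < 1 -> g0 (u ^ 2 / 2) = exp (- (u / 2 * excess u)).
Proof.
  intros Hu.
  destruct (scaled_log_bounds u (1 / 2) ltac:(lra) ltac:(nra) ltac:(lra)) as [Hy _].
  unfold g0. cbv zeta. rewrite sqrt_two_div by lra.
  replace (sqrt (u ^ 2 / 2 / 2)) with (u / 2).
  2: { replace (u ^ 2 / 2 / 2) with (u / 2 * (u / 2)) by field.
       rewrite sqrt_square; lra. }
  replace (1 - 2 * (u ^ 2 / 2) * (1 - u ^ 2 / 2)) with (1 - u ^ 2 + u ^ 4 / 2) by field.
  assert (Hq : 0 < 1 - u ^ 2 / 2) by nra.
  assert (HA : 0 < 1 - u ^ 2 + u ^ 4 / 2) by nra.
  assert (Hy1 : 0 < 1 - 2 / u * ln (1 - u ^ 2 / 2)) by nra.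
  unfold Rpower.
  rewrite ln_div by (try apply Rmult_lt_0_compat; lra).
  rewrite ln_mult by lra.
  replace (1 / (1 - u ^ 2 / 2)) with (exp (- ln (1 - u ^ 2 / 2))).
  2: { rewrite exp_Ropp, exp_ln by lra. field. lra. }
  rewrite <- exp_plus. f_equal. unfold excess. field. lra.
Qed.

(** * The weight that decides the sign of the increments *)

(** The increment t(N+1) - t(N) has the sign of
    [weight_threshold p - step_weight p N]; a real argument allows comparison at
    s - 1, s and s + 1, where s = sqrt (2/p) is not an integer. *)
Definition step_weight (p x : R) : R := Rpower (1 - p) (x + 1) * (1 + p * x).

Lemma ln_one_sub_lt (p : R) : 0 < p < 1 -> ln (1 - p) < - p.
Proof.
  intros Hp. pose proof (opp_ln_ge p ltac:(lra)). nra.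
Qed.

(** From x to y the factor 1 + p x grows at most by 1 + p (y - x), which is less
    than exp (p (y - x)), while the power of q shrinks by more than that. *)
Lemma step_weight_decreasing (p x y : R) :
  0 < p < 1 -> 0 <= x < y -> step_weight p y < step_weight p x.
Proof.
  intros Hp Hxy. unfold step_weight, Rpower.
  replace ((y + 1) * ln (1 - p)) with ((x + 1) * ln (1 - p) + (y - x) * ln (1 - p)) by ring.
  rewrite exp_plus, Rmult_assoc.
  apply Rmult_lt_compat_l; [apply exp_pos |].
  assert (Hpx : 0 <= p * x) by (apply Rmult_le_pos; lra).
  assert (Hd : 0 < p * (y - x)) by (apply Rmult_lt_0_compat; lra).
  apply Rlt_le_trans with (exp (- (p * (y - x))) * (1 + p * y)).
  - apply Rmult_lt_compat_r; [nra |].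
    apply exp_increasing. pose proof (ln_one_sub_lt p Hp). nra.
  - rewrite exp_Ropp.
    apply Rmult_le_reg_l with (exp (p * (y - x))); [apply exp_pos |].
    rewrite <- Rmult_assoc, Rinv_r, Rmult_1_l by (pose proof (exp_pos (p * (y - x))); lra).
    pose proof (exp_ineq1_le (p * (y - x))). nra.
Qed.

Definition weight_threshold (p : R) : R := 1 - 2 * p * (1 - p).

Lemma threshold_eq (u : R) : weight_threshold (u ^ 2 / 2) = 1 - u ^ 2 + u ^ 4 / 2.
Proof. unfold weight_threshold. field. Qed.

Lemma step_weight_before (u : R) :
  0 < u <= 1 / 2 -> weight_threshold (u ^ 2 / 2) < step_weight (u ^ 2 / 2) (2 / u - 1).
Proof.
  intros Hu. rewrite threshold_eq.
  assert (HA : 0 < 1 - u ^ 2 + u ^ 4 / 2) by nra.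
  assert (Hx : 0 < 1 + (u - u ^ 2 / 2)) by nra.
  unfold step_weight, Rpower.
  replace (1 + u ^ 2 / 2 * (2 / u - 1)) with (1 + (u - u ^ 2 / 2)) by (field; lra).
  replace (2 / u - 1 + 1) with (2 / u) by ring.
  rewrite <- (exp_ln (1 + (u - u ^ 2 / 2))) by lra.
  rewrite <- (exp_ln (1 - u ^ 2 + u ^ 4 / 2)) by lra.
  rewrite <- exp_plus. apply exp_increasing.
  pose proof (shifted_bound_small u Hu). lra.
Qed.

(** The weight at s is q^(s+1) (1 + p s), and p < - ln q bounds it by
    q^(s+1) (1 - s ln q), whose logarithm [excess] compares with the threshold. *)
Lemma step_weight_at (u : R) :
  0 < u < 1 -> excess u <= 0 ->
  step_weight (u ^ 2 / 2) (2 / u) < weight_threshold (u ^ 2 / 2).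
Proof.
  intros Hu He. rewrite threshold_eq.
  destruct (scaled_log_bounds u (1 / 2) ltac:(lra) ltac:(nra) ltac:(lra)) as [Hy _].
  assert (HA : 0 < 1 - u ^ 2 + u ^ 4 / 2) by nra.
  unfold step_weight, Rpower.
  replace (u ^ 2 / 2 * (2 / u)) with u by (field; lra).
  assert (Hlt : u < u * (1 + u ^ 2 / 4)) by (pose proof (pow_lt u 3 ltac:(lra)); lra).
  apply Rlt_le_trans with
    (exp ((2 / u + 1) * ln (1 - u ^ 2 / 2)) * (1 - 2 / u * ln (1 - u ^ 2 / 2))).
  - apply Rmult_lt_compat_l; [apply exp_pos | lra].
  - assert (Hy1 : 0 < 1 - 2 / u * ln (1 - u ^ 2 / 2)) by lra.
    rewrite <- (exp_ln (1 - u ^ 2 + u ^ 4 / 2)) by lra.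
    rewrite <- (exp_ln (1 - 2 / u * ln (1 - u ^ 2 / 2))) by lra.
    rewrite <- exp_plus. apply Rnot_lt_le. intros Hlt'%exp_lt_inv.
    unfold excess in He. lra.
Qed.

(** Here 1 + p (s+1) = 1 + u + u^2/2 < exp u, while q < exp (- p) gives
    q^(s+2) < exp (- u - u^2); the product is below exp (- u^2), which is at most
    1 - u^2 + u^4/2, the threshold. *)
Lemma step_weight_after (u : R) :
  0 < u < 1 ->
  step_weight (u ^ 2 / 2) (2 / u + 1) < weight_threshold (u ^ 2 / 2).
Proof.
  intros Hu. rewrite threshold_eq.
  unfold step_weight, Rpower.
  replace (1 + u ^ 2 / 2 * (2 / u + 1)) with (1 + u + u ^ 2 / 2) by (field; lra).
  pose proof (exp_opp_le_taylor2 (u ^ 2) ltac:(nra)) as HA.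
  replace ((u ^ 2) ^ 2) with (u ^ 4) in HA by ring.
  apply Rlt_le_trans with (exp (- u ^ 2)); trivial.
  replace (- u ^ 2) with (- (u + u ^ 2) + u) by ring.
  rewrite exp_plus.
  apply Rmult_le_0_lt_compat; [apply Rlt_le, exp_pos | nra | | apply exp_gt_taylor2; lra].
  apply exp_increasing.
  replace (- (u + u ^ 2)) with ((2 / u + 1 + 1) * - (u ^ 2 / 2)) by (field; lra).
  apply Rmult_lt_compat_l.
  - assert (0 < 2 / u) by (apply Rdiv_lt_0_compat; lra). lra.
  - apply ln_one_sub_lt. nra.
Qed.

Lemma step_weight_INR (p : R) (n : nat) :
  0 < p < 1 -> step_weight p (INR n) = (1 - p) ^ (n + 1) * (1 + p * INR n).
Proof.
  intros Hp. unfold step_weight. f_equal.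
  rewrite <- Rpower_pow by lra. f_equal. rewrite plus_INR. reflexivity.
Qed.

(** The bound at s - 1 is false for p near (3 - sqrt 5)/2, so the small values 2
    and 3 of the floor are treated with D(1) and D(2) themselves:
    D(1) - A = p (1 - 3p + p^2) and D(2) - A = p (1 - 5p + 5p^2 - 2p^3). *)
Lemma step_weight_below_floor (p : R) (m : nat) :
  0 < p < (3 - sqrt 5) / 2 ->
  INR m <= sqrt (2 / p) < INR m + 1 ->
  (2 <= m)%nat ->
  weight_threshold p < step_weight p (INR (m - 1)).
Proof.
  intros Hp Hm Hm2.
  assert (Hs5 : 0 <= sqrt 5) by apply sqrt_pos.
  assert (Hs5' : sqrt 5 * sqrt 5 = 5) by (apply sqrt_sqrt; lra).
  assert (Hsq : sqrt (2 / p) * sqrt (2 / p) * p = 2).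
  { rewrite sqrt_sqrt; [field; lra |]. apply Rlt_le, Rdiv_lt_0_compat; lra. }
  assert (Hm0 : 2 <= INR m) by (change 2 with (INR 2); apply le_INR; lia).
  assert (Hlow : INR m * INR m * p <= 2).
  { rewrite <- Hsq. apply Rmult_le_compat_r; [lra |]. apply Rmult_le_compat; lra. }
  assert (p < 4 / 10) by nra.
  destruct (Nat.eq_dec m 2) as [-> | H2]; [| destruct (Nat.eq_dec m 3) as [-> | H3]].
  - rewrite step_weight_INR by lra. unfold weight_threshold. simpl.
    assert (0 < p * (1 - 3 * p + p ^ 2)) by (apply Rmult_lt_0_compat; nra).
    nra.
  - rewrite step_weight_INR by lra. unfold weight_threshold. simpl in *.
    assert (Hp9 : p <= 2 / 9) by lra.
    assert (0 <= p ^ 2 * (1 - 2 * p)) by (apply Rmult_le_pos; nra).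
    assert (0 < p * (1 - 5 * p + 5 * p ^ 2 - 2 * p ^ 3)) by (apply Rmult_lt_0_compat; nra).
    nra.
  - assert (H4 : INR 4 <= INR m) by (apply le_INR; lia). simpl in H4.
    assert (H16 : 16 <= INR m * INR m) by nra.
    assert (Hp8 : p <= 1 / 8) by nra.
    set (u := sqrt (2 * p)).
    assert (Hu : 0 < u) by (apply sqrt_lt_R0; lra).
    assert (Huu : u * u = 2 * p) by (apply sqrt_sqrt; lra).
    assert (Ep : p = u ^ 2 / 2) by (simpl; lra).
    assert (Hu1 : u <= 1 / 2) by nra.
    rewrite minus_INR by lia. rewrite Ep, sqrt_two_div in Hm by lra.
    rewrite Ep. simpl (INR 1).
    apply Rlt_le_trans with (step_weight (u ^ 2 / 2) (2 / u - 1)).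
    + apply step_weight_before. lra.
    + destruct (proj1 Hm) as [Hlt | ->]; [| lra].
      apply Rlt_le, step_weight_decreasing; lra.
Qed.

(** * Optimal configurations *)

Lemma tS_succ_sub (p : R) (N : nat) :
  0 < p < 1 -> (1 <= N)%nat ->
  tS (S N) p - tS N p
  = (weight_threshold p - step_weight p (INR N)) / (p * INR N * (INR N + 1)).
Proof.
  intros Hp HN.
  rewrite !tS_formula, step_weight_INR by (trivial; lia).
  rewrite S_INR, !Nat.add_1_r, <- !tech_pow_Rmult.
  assert (0 < INR N) by (apply lt_0_INR; lia).
  unfold weight_threshold. field. lra.
Qed.

Lemma tS_le_succ_iff (p : R) (N : nat) :
  0 < p < 1 -> (1 <= N)%nat ->
  (tS N p <= tS (S N) p <-> step_weight p (INR N) <= weight_threshold p) /\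
  (tS (S N) p <= tS N p <-> weight_threshold p <= step_weight p (INR N)).
Proof.
  intros Hp HN. pose proof (tS_succ_sub p N Hp HN) as H.
  assert (HI : 0 < INR N) by (apply lt_0_INR; lia).
  assert (HD : 0 < p * INR N * (INR N + 1)) by (repeat apply Rmult_lt_0_compat; lra).
  assert (Hinv := Rinv_0_lt_compat _ HD).
  unfold Rdiv in H. split; split; intros; nra.
Qed.

Lemma optimal_ge (p : R) (N m : nat) :
  0 < p < 1 -> optimal_configuration tS p N ->
  weight_threshold p < step_weight p (INR (m - 1)) -> (m <= N)%nat.
Proof.
  intros Hp [HN Hopt] Hm. apply Nat.nlt_ge. intros Hlt.
  pose proof (proj1 (proj1 (tS_le_succ_iff p N Hp HN)) (Hopt (S N) ltac:(lia))) as H.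
  destruct (Nat.eq_dec N (m - 1)) as [E | NE].
  - rewrite <- E in Hm. lra.
  - assert (step_weight p (INR (m - 1)) < step_weight p (INR N)); [| lra].
    apply step_weight_decreasing; trivial.
    split; [apply pos_INR | apply lt_INR; lia].
Qed.

Lemma optimal_le (p x : R) (N m : nat) :
  0 < p < 1 -> optimal_configuration tS p N ->
  0 <= x < INR m -> step_weight p x < weight_threshold p -> (N <= m)%nat.
Proof.
  intros Hp [HN Hopt] Hx Hw. apply Nat.nlt_ge. intros Hlt.
  destruct N as [| n]; [lia |].
  assert (Hm : (1 <= m)%nat) by (apply INR_lt; simpl; lra).
  pose proof (proj1 (proj2 (tS_le_succ_iff p n Hp ltac:(lia))) (Hopt n ltac:(lia))) as H.
  assert (step_weight p (INR n) < step_weight p x); [| lra].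
  apply step_weight_decreasing; trivial.
  assert (INR m <= INR n) by (apply le_INR; lia). lra.
Qed.

Lemma finite_argmin (f : nat -> R) (K : nat) :
  (1 <= K)%nat ->
  exists N, (1 <= N)%nat /\ forall M, (1 <= M <= K)%nat -> f N <= f M.
Proof.
  induction K as [| K IH]; [lia |]. intros _.
  destruct (Nat.eq_dec K 0) as [-> | HK].
  - exists 1%nat. split; [lia |]. intros M HM. replace M with 1%nat by lia. lra.
  - destruct (IH ltac:(lia)) as [N [HN Hmin]].
    destruct (Rle_or_lt (f N) (f (S K))) as [Hle | Hlt].
    + exists N. split; trivial. intros M HM.
      destruct (Nat.eq_dec M (S K)) as [-> | HM']; [lra | apply Hmin; lia].
    + exists (S K). split; [lia |]. intros M HM.
      destruct (Nat.eq_dec M (S K)) as [-> | HM']; [lra |].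
      specialize (Hmin M ltac:(lia)). lra.
Qed.

(** Beyond any x where the weight is below the threshold, t increases, so the
    minimum over all batch sizes is attained on a finite initial range. *)
Lemma optimal_exists (p x : R) :
  0 < p < 1 -> 0 <= x -> step_weight p x < weight_threshold p ->
  exists N, optimal_configuration tS p N.
Proof.
  intros Hp Hx Hw.
  destruct (INR_unbounded x) as [m Hm].
  assert (Hm1 : (1 <= m)%nat) by (apply INR_lt; simpl; lra).
  destruct (finite_argmin (fun N => tS N p) m Hm1) as [N [HN Hmin]].
  assert (Htail : forall d, tS m p <= tS (m + d) p).
  { induction d as [| d IH]; [rewrite Nat.add_0_r; lra |].
    apply Rle_trans with (1 := IH). rewrite Nat.add_succ_r.
    apply tS_le_succ_iff; [trivial | lia |].
    apply Rlt_le, Rlt_trans with (2 := Hw), step_weight_decreasing; trivial.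
    rewrite plus_INR. pose proof (pos_INR d). lra. }
  exists N. split; trivial. intros M HM.
  destruct (Nat.le_gt_cases M m) as [Hle | Hgt].
  - apply Hmin. lia.
  - apply Rle_trans with (1 := Hmin m ltac:(lia)).
    replace M with (m + (M - m))%nat by lia. apply Htail.
Qed.

Lemma prevalence_bound (p : R) : p < (3 - sqrt 5) / 2 -> p < 382 / 1000.
Proof.
  intros Hp.
  assert (2236 / 1000 < sqrt 5); [| lra].
  rewrite <- (sqrt_square (2236 / 1000)) by lra. apply sqrt_lt_1; lra.
Qed.

Lemma prevalence_parametrization (p : R) :
  0 < p < 382 / 1000 -> exists u, 0 < u < 1 /\ p = u ^ 2 / 2.
Proof.
  intros Hp. exists (sqrt (2 * p)).
  assert (Hu : 0 < sqrt (2 * p)) by (apply sqrt_lt_R0; lra).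
  assert (Huu : sqrt (2 * p) * sqrt (2 * p) = 2 * p) by (apply sqrt_sqrt; lra).
  split; [split; nra | simpl; lra].
Qed.

Lemma Int_part_nat (x : R) :
  2 <= x -> exists m : nat,
    Int_part x = Z.of_nat m /\ (2 <= m)%nat /\ INR m <= x < INR m + 1.
Proof.
  intros Hx. destruct (base_Int_part x) as [H1 H2].
  assert (H : (1 < Int_part x)%Z) by (apply lt_IZR; lra).
  exists (Z.to_nat (Int_part x)). rewrite INR_IZR_INZ, Z2Nat.id by lia.
  repeat split; try lia; lra.
Qed.

Theorem proposition2p1 :
  (forall (p : R) (N : nat), 0 < p < 1 -> (1 <= N)%nat ->
     let q := 1 - p in
     tS N p = 2 - q + (2 * q - / p * (1 - q ^ (N + 1))) / INR N) /\
  exists pstar : R,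
    (forall p : R, (0 < p < (3 - sqrt 5) / 2 /\ g0 p = 1) <-> p = pstar) /\
    Rabs (pstar - 1711 / 10000) <= 5 / 100000 /\
    (forall p : R, 0 < p < (3 - sqrt 5) / 2 ->
       exists N : nat, optimal_configuration tS p N) /\
    (forall (p : R) (N : nat),
       pstar < p < (3 - sqrt 5) / 2 -> optimal_configuration tS p N ->
       let k := Int_part (sqrt (2 * / p)) in
       Z.of_nat N = k \/ Z.of_nat N = (k + 1)%Z) /\
    (forall (p : R) (N : nat),
       0 < p <= pstar -> optimal_configuration tS p N ->
       let k := Int_part (sqrt (2 * / p)) in
       Z.of_nat N = k \/ Z.of_nat N = (k + 1)%Z \/ Z.of_nat N = (k + 2)%Z).
Proof.
  split; [exact tS_formula |].
  destruct excess_sign as [ustar [Hustar [Hroot [Hpos Hneg]]]].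
  assert (Hstar : 17105 / 100000 <= ustar ^ 2 / 2 <= 17115 / 100000) by nra.
  assert (Hthr : 38 / 100 < (3 - sqrt 5) / 2).
  { assert (sqrt 5 < 224 / 100); [| lra].
    rewrite <- (sqrt_square (224 / 100)) by lra. apply sqrt_lt_1; lra. }
  assert (Hfloor : forall p, 0 < p < (3 - sqrt 5) / 2 -> exists m : nat,
    Int_part (sqrt (2 * / p)) = Z.of_nat m /\ sqrt (2 / p) < INR m + 1 /\
    weight_threshold p < step_weight p (INR (m - 1))).
  { intros p Hp. pose proof (prevalence_bound p (proj2 Hp)) as Hp'.
    destruct (Int_part_nat (sqrt (2 / p))) as [m [Em [Hm2 Hm]]].
    - rewrite <- (sqrt_square 2) at 1 by lra. apply sqrt_le_1_alt, (Rle_div_r (2 * 2)); lra.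
    - exists m. split; [exact Em | split; [lra |]].
      apply step_weight_below_floor; trivial. }
  exists (ustar ^ 2 / 2). split; [| split; [| split; [| split]]].
  - intros p. split.
    + intros [Hp Hg].
      pose proof (prevalence_bound p (proj2 Hp)) as Hp'.
      destruct (prevalence_parametrization p ltac:(lra)) as [u [Hu ->]].
      rewrite g0_excess, <- exp_0 in Hg by lra. apply exp_inv in Hg.
      destruct (Rtotal_order u ustar) as [Hlt | [-> | Hgt]]; trivial; exfalso.
      * specialize (Hpos u ltac:(lra)). nra.
      * specialize (Hneg u Hgt ltac:(lra)). nra.
    + intros ->. split; [lra |].
      rewrite g0_excess, Hroot, Rmult_0_r, Ropp_0 by lra. apply exp_0.
  - apply Rabs_le. lra.
  - intros p Hp. pose proof (prevalence_bound p (proj2 Hp)) as Hp'.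
    destruct (prevalence_parametrization p ltac:(lra)) as [u [Hu ->]].
    apply optimal_exists with (2 / u + 1); [nra | | apply step_weight_after; lra].
    assert (0 < 2 / u) by (apply Rdiv_lt_0_compat; lra). lra.
  - intros p N Hp Hopt. cbv zeta.
    pose proof (prevalence_bound p (proj2 Hp)) as Hp'.
    destruct (Hfloor p ltac:(lra)) as [m [-> [Hm Hw]]].
    pose proof (optimal_ge p N m ltac:(lra) Hopt Hw) as Hge.
    assert (Hle : (N <= m + 1)%nat); [| lia].
    destruct (prevalence_parametrization p ltac:(lra)) as [u [Hu ->]].
    rewrite sqrt_two_div in Hm by lra.
    apply optimal_le with (2 := Hopt) (x := 2 / u); [lra | |].
    + rewrite plus_INR. simpl (INR 1).
      assert (0 < 2 / u) by (apply Rdiv_lt_0_compat; lra). lra.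
    + apply step_weight_at; [lra |]. apply Rlt_le, Hneg; nra.
  - intros p N Hp Hopt. cbv zeta.
    destruct (Hfloor p ltac:(lra)) as [m [-> [Hm Hw]]].
    pose proof (optimal_ge p N m ltac:(lra) Hopt Hw) as Hge.
    assert (Hle : (N <= m + 2)%nat); [| lia].
    destruct (prevalence_parametrization p ltac:(lra)) as [u [Hu ->]].
    rewrite sqrt_two_div in Hm by lra.
    apply optimal_le with (2 := Hopt) (x := 2 / u + 1); [lra | |].
    + rewrite plus_INR. simpl (INR 2).
      assert (0 < 2 / u) by (apply Rdiv_lt_0_compat; lra). lra.
    + apply step_weight_after. lra.
Qed.
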